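(* Let $T$ be a quadratic Leibman sequence in a group $G$. The discrete differences $\Delta^iT$, $\Delta^i\Delta^jT$ ($i,j\in\mathbb Z$) generate a subgroup $\langle\Delta^{\circ}T\rangle$ of $G^{\mathbb Z}$ isomorphic to a factor (quotient group) of $\mathbb Z\wr\mathbb Z$. Actually, $\langle\Delta^{\circ}T\rangle$ is already generated by $A=\Delta^1\Delta^1T$ and $B=\Delta^1T$. The values $(\Delta^iT)_m$, $(\Delta^i\Delta^jT)_m$ ($i,j,m\in\mathbb Z$) of these discrete differences generate a subgroup $\langle\Delta^{\circ}T\rangle_\bullet$ of $G$ also isomorphic to a factor of $\mathbb Z\wr\mathbb Z$. In fact, $a=A_0$ and $b=B_0$ already generate $\langle\Delta^{\circ}T\rangle_\bullet$. Furthermore, there exists a quadratic Leibman sequence $T$ (in some group) such that both $\langle\Delta^{\circ}T\rangle$ and $\langle\Delta^{\circ}T\rangle_\bullet$ are isomorphic to $\mathbb Z\wr\mathbb Z$ itself.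
   Context: $G^{\mathbb Z}$ is the group of sequences $\mathbb Z\to G$ under pointwise multiplication. For $T\in G^{\mathbb Z}$ and $i\in\mathbb Z$, the discrete difference $\Delta^iT\in G^{\mathbb Z}$ is $(\Delta^iT)_j=T_{i+j}T_j^{-1}$. $T$ is a Leibman sequence of degree at most $d\in\mathbb N$ if $\Delta^{i_d}\cdots\Delta^{i_1}\Delta^{i_0}T$ is the constant sequence with value the identity, for all $i_0,\dots,i_d\in\mathbb Z$. Quadratic means of degree at most $2$. $\mathbb Z\wr\mathbb Z$ (the ''lamplighter group'') is the restricted wreath product of $\mathbb Z$ with itself, presented by generators $(\alpha_k:k\in\mathbb Z)$ and $\beta$ with relations $\alpha_k\alpha_l=\alpha_l\alpha_k$ and $\beta^k\alpha_l=\alpha_{k+l}\beta^k$ for all $k,l\in\mathbb Z$. *)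

(* Defs.v *)
From HB Require Import structures.
From mathcomp Require Import all_boot all_order all_algebra.
From mathcomp Require Import finmap.
From mathcomp Require Import boolp classical_sets.

Set Implicit Arguments.
Unset Strict Implicit.
Unset Printing Implicit Defensive.

Import GRing.Theory.

Local Open Scope classical_set_scope.
Local Open Scope group_scope.

Section Generated.
Variable G : groupType.
Implicit Types (S : set G) (x y : G).

Definition generated S : set G :=
  smallest [set H : set G | group_closed (mem H)] S.

Lemma generated_group_closed S : group_closed (mem (generated S)).
Proof.
split=> [|x y /set_mem xS /set_mem yS]; apply/mem_set => H [Hg SH].
  by have [/set_mem] := Hg.
by apply/set_mem; apply: Hg.2; apply/mem_set; [apply: xS | apply: yS].
Qed.

Definition generated_group S : Type := {x : G | x \in generated S}.

HB.instance Definition _ S := [isSub of generated_group S for @sval _ _].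
HB.instance Definition _ S := [Choice of generated_group S by <:].
HB.instance Definition _ S := SubChoice_isSubGroup.Build G _
  (generated_group S) (generated_group_closed S).

End Generated.

Record normal_subgroup (G : groupType) := NormalSubgroup {
  normal_set :> set G;
  normal_closed : group_closed (mem normal_set);
  normal_conj : forall x y : G, x \in normal_set -> x ^ y \in normal_set
}.

Section Quotient.
Variables (G : groupType) (N : normal_subgroup G).
Implicit Types x y : G.
Local Open Scope quotient_scope.

Definition coset_rel x y : bool := x^-1 * y \in (N : set G).

Lemma coset_rel_is_equiv : equiv_class_of coset_rel.
Proof.
have [N1 _] := normal_closed N.
have NV := group_closedV (normal_closed N).
have NM := group_closedM (normal_closed N).
split=> [x|x y|y x z]; rewrite /coset_rel ?mulVg //.
- by apply/idP/idP => /NV; rewrite invgM invgK.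
- by move=> xy yz; have := NM _ _ xy yz; rewrite mulgA mulgK.
Qed.

Canonical coset_rel_equiv := EquivRelPack coset_rel_is_equiv.

Definition quotient := {eq_quot coset_rel}.

HB.instance Definition _ := Choice.on quotient.
HB.instance Definition _ := EqQuotient.on quotient.

Definition quotient_one : quotient := \pi_quotient 1.
Definition quotient_inv (u : quotient) : quotient := \pi_quotient ((repr u)^-1).
Definition quotient_mul (u v : quotient) : quotient :=
  \pi_quotient (repr u * repr v).

Lemma quotient_eqP x y : reflect (\pi_quotient x = \pi_quotient y)
                                 (x^-1 * y \in (N : set G)).
Proof. exact: (@eqquotP _ _ quotient). Qed.

Lemma repr_rel x : x^-1 * repr (\pi_quotient x) \in (N : set G).
Proof. by apply/quotient_eqP; rewrite reprK. Qed.

Lemma quotient_piM x y :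
  \pi_quotient (x * y) = quotient_mul (\pi_quotient x) (\pi_quotient y).
Proof.
apply/quotient_eqP.
have NM := group_closedM (normal_closed N).
have := NM _ _ (normal_conj y (repr_rel x)) (repr_rel y).
by rewrite conjgE !mulgA mulgK invgM.
Qed.

Lemma quotient_piV x : \pi_quotient (x^-1) = quotient_inv (\pi_quotient x).
Proof.
apply/quotient_eqP.
have := normal_conj x^-1 (group_closedV (normal_closed N) (repr_rel x)).
by rewrite conjgE !invgM !invgK !mulgA mulgK.
Qed.

Lemma quotient_mulA : associative quotient_mul.
Proof.
move=> u v w; rewrite -[u]reprK -[v]reprK -[w]reprK.
move: (repr u) (repr v) (repr w) => x y z.
by rewrite -(quotient_piM y) -(quotient_piM x y) -!quotient_piM mulgA.
Qed.

Lemma quotient_mul1 : left_id quotient_one quotient_mul.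
Proof. by move=> u; rewrite -[u]reprK -quotient_piM mul1g. Qed.

Lemma quotient_1mul : right_id quotient_one quotient_mul.
Proof. by move=> u; rewrite -[u]reprK -quotient_piM mulg1. Qed.

Lemma quotient_mulV : left_inverse quotient_one quotient_inv quotient_mul.
Proof. by move=> u; rewrite -[u]reprK -quotient_piV -quotient_piM mulVg. Qed.

Lemma quotient_Vmul : right_inverse quotient_one quotient_inv quotient_mul.
Proof. by move=> u; rewrite -[u]reprK -quotient_piV -quotient_piM mulgV. Qed.

HB.instance Definition _ := isGroup.Build quotient
  quotient_mulA quotient_mul1 quotient_1mul quotient_mulV quotient_Vmul.

End Quotient.

Definition isomorphic (G H : groupType) : Prop :=
  exists f : {multiplicative G -> H}, bijective f.

(* H is isomorphic to a factor of G *)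
Definition iso_factor (H G : groupType) : Prop :=
  exists N : normal_subgroup G, isomorphic (quotient N) H.

Definition zseq (G : Type) := int -> G.

Section SequenceGroup.
Variable G : groupType.
Implicit Types S T U : zseq G.

HB.instance Definition _ := Choice.copy (zseq G) (int -> G).

Definition zseq_one : zseq G := fun=> 1.
Definition zseq_inv T : zseq G := fun j => (T j)^-1.
Definition zseq_mul T U : zseq G := fun j => T j * U j.

Lemma zseq_mulA : associative zseq_mul.
Proof. by move=> S T U; apply/funext => j; apply: mulgA. Qed.
Lemma zseq_mul1 : left_id zseq_one zseq_mul.
Proof. by move=> T; apply/funext => j; apply: mul1g. Qed.
Lemma zseq_1mul : right_id zseq_one zseq_mul.
Proof. by move=> T; apply/funext => j; apply: mulg1. Qed.
Lemma zseq_mulV : left_inverse zseq_one zseq_inv zseq_mul.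
Proof. by move=> T; apply/funext => j; apply: mulVg. Qed.
Lemma zseq_Vmul : right_inverse zseq_one zseq_inv zseq_mul.
Proof. by move=> T; apply/funext => j; apply: mulgV. Qed.

HB.instance Definition _ := isGroup.Build (zseq G)
  zseq_mulA zseq_mul1 zseq_1mul zseq_mulV zseq_Vmul.

End SequenceGroup.

Section Leibman.
Variable G : groupType.

Definition Delta (i : int) (T : zseq G) : zseq G :=
  fun j => T (i + j)%R * (T j)^-1.

(* foldl applies the difference of the first entry of s first *)
Definition leibman (d : nat) (T : zseq G) : Prop :=
  forall s : d.+1.-tuple int, foldl (fun U i => Delta i U) T s = 1.

Definition quadratic_leibman (T : zseq G) : Prop := leibman 2 T.

Definition differences (T : zseq G) : set (zseq G) :=
  [set Delta i T | i in [set: int]] `|`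
  [set Delta i (Delta j T) | i in [set: int] & j in [set: int]].

Definition difference_values (T : zseq G) : set G :=
  [set U m | U in differences T & m in [set: int]].

End Leibman.

(* The restricted wreath product of Z with itself: pairs (u, n) of a finitely
   supported u : Z -> Z and n in Z, the latter acting by translation.  The
   standard generators are alpha_k = (indicator of k, 0) and beta = (0, 1), so
   that beta^k alpha_l = alpha_(k + l) beta^k and
   (u, n) = (\prod_k alpha_k^(u k)) beta^n. *)

Definition lamplighter : Type := {fsfun int -> int with 0%R} * int.

Section Lamplighter.
Local Open Scope fset_scope.
Implicit Types u v : {fsfun int -> int with 0%R}.
Implicit Types (x y z : lamplighter) (m n k : int).

Definition fs_shift n u : {fsfun int -> int with 0%R} :=
  [fsfun k in [fset (n + k)%R | k in finsupp u] => u (k - n)%R].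

Definition fs_add u v : {fsfun int -> int with 0%R} :=
  [fsfun k in finsupp u `|` finsupp v => (u k + v k)%R].

Definition fs_opp u : {fsfun int -> int with 0%R} :=
  [fsfun k in finsupp u => (- u k)%R].

Lemma fs_shiftE n u k : fs_shift n u k = u (k - n)%R.
Proof.
rewrite fsfunE; case: ifPn => // /negP kNu; apply/esym/fsfun_dflt/negP => knu.
by apply/kNu/imfsetP; exists (k - n)%R; rewrite // addrC subrK.
Qed.

Lemma fs_addE u v k : fs_add u v k = (u k + v k)%R.
Proof.
rewrite fsfunE in_fsetU; case: ifPn => //.
by rewrite negb_or => /andP[/fsfun_dflt-> /fsfun_dflt->].
Qed.

Lemma fs_oppE u k : fs_opp u k = (- u k)%R.
Proof. by rewrite fsfunE; case: ifPn => // /fsfun_dflt->. Qed.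

Definition fsE := (fs_shiftE, fs_addE, fs_oppE, fsfun0E).

Definition lamplighter_one : lamplighter := ([fsfun], 0%R).
Definition lamplighter_mul x y : lamplighter :=
  (fs_add x.1 (fs_shift x.2 y.1), (x.2 + y.2)%R).
Definition lamplighter_inv x : lamplighter :=
  (fs_opp (fs_shift (- x.2)%R x.1), (- x.2)%R).

HB.instance Definition _ :=
  Choice.copy lamplighter ({fsfun int -> int with 0%R} * int)%type.

Lemma lamplighter_mulA : associative lamplighter_mul.
Proof.
move=> x y z; congr (_, _); last exact: addrA.
by apply/fsfunP => k; rewrite /= !fsE addrA opprD (addrA k).
Qed.

Lemma lamplighter_mul1 : left_id lamplighter_one lamplighter_mul.
Proof.
move=> [u n]; congr (_, _); last exact: add0r.
by apply/fsfunP => k; rewrite !fsE subr0 add0r.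
Qed.

Lemma lamplighter_1mul : right_id lamplighter_one lamplighter_mul.
Proof.
move=> [u n]; congr (_, _); last exact: addr0.
by apply/fsfunP => k; rewrite !fsE addr0.
Qed.

Lemma lamplighter_mulV :
  left_inverse lamplighter_one lamplighter_inv lamplighter_mul.
Proof.
move=> [u n]; congr (_, _); last exact: addNr.
by apply/fsfunP => k; rewrite !fsE addNr.
Qed.

Lemma lamplighter_Vmul :
  right_inverse lamplighter_one lamplighter_inv lamplighter_mul.
Proof.
move=> [u n]; congr (_, _); last exact: addrN.
by apply/fsfunP => k; rewrite !fsE /= opprK subrK addrN.
Qed.

HB.instance Definition _ := isGroup.Build lamplighter
  lamplighter_mulA lamplighter_mul1 lamplighter_1mul
  lamplighter_mulV lamplighter_Vmul.

End Lamplighter.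

(* Main.v *)
Require Import Defs.
From HB Require Import structures.
From mathcomp Require Import all_boot all_order all_algebra.
From mathcomp Require Import finmap ring zify.
From mathcomp Require Import boolp classical_sets.

(* For quadratic T the second differences are constant, and B := Delta 1 T
   satisfies B (i + m) = a^i * B m with a := (Delta 1 (Delta 1 T)) 0.
   Expressing the constant c_(i+1) := Delta 1 (Delta (i+1) T) through c_i at two
   consecutive positions shows that a commutes with c_i ^ (B m)^-1, so that
   c_(i+1) = a * c_i ^ (B m)^-1, and hence c_i^-1 * c_(i+1) is the conjugate of
   a by (B m)^-i.  Therefore a commutes with all its conjugates by powers of
   B m, which are the defining relations of the lamplighter group.

   The universal example takes values in the lamplighter group and has
   (a, b) = (alpha_0, beta): the endomorphism of the lamplighter group so
   induced is the identity, so the morphisms onto both groups generated by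
   differences are injective. *)

Set Implicit Arguments.
Unset Strict Implicit.
Unset Printing Implicit Defensive.

Import Order.TTheory GRing.Theory Num.Theory.

Local Open Scope classical_set_scope.
Local Open Scope group_scope.

(** * Induction over the integers and integer powers *)

(** With an equivalence as induction step, one cancellation argument serves both the positive and
    the negative integers. *)
Lemma int_ind_succ (P : int -> Prop) :
  P 0%R -> (forall i, P i <-> P (i + 1)%R) -> forall i, P i.
Proof.
move=> P0 PS; elim/int_rect=> // n; first by move/PS; rewrite intS addrC.
by move=> Pn; apply/PS; rewrite intS opprD addrAC addNr add0r.
Qed.

Section IntegerPowers.
Variable G : groupType.
Implicit Types (x y : G) (m n : int).

Definition zexpg x n : G :=
  match n with Posz k => x ^+ k | Negz k => x ^- k.+1 end.

Lemma zexpgSr x n : zexpg x (n + 1)%R = zexpg x n * x.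
Proof.
case: n => [n|[|n]]; first by rewrite -PoszD addn1 /= expgSr.
  by rewrite /= mulVg.
have -> : (Negz n.+1 + 1)%R = Negz n by lia.
by rewrite /= [x ^+ n.+2]expgS invgM mulgVK.
Qed.

Lemma zexpgD x m n : zexpg x (m + n)%R = zexpg x m * zexpg x n.
Proof.
elim/int_ind_succ: n => [|n]; first by rewrite addr0 mulg1.
rewrite addrA !zexpgSr mulgA; split=> [->//|]; exact: mulIg.
Qed.

Lemma zexpgN x n : zexpg x (- n)%R = (zexpg x n)^-1.
Proof. by apply/esym/mulg1_eq; rewrite -zexpgD subrr. Qed.

Lemma zexpgS x n : zexpg x (n + 1)%R = x * zexpg x n.
Proof. by rewrite addrC zexpgD. Qed.

Lemma commute_zexpg x y n : commute x y -> commute x (zexpg y n).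
Proof.
by move=> xy; case: n => n; [apply: commuteX | apply/commuteV/commuteX].
Qed.

Lemma conjg_zexpg x y n : zexpg x n ^ y = zexpg (x ^ y) n.
Proof. by case: n => n /=; rewrite ?conjVg conjXg. Qed.

End IntegerPowers.

Lemma gmulf_zexpg (G H : groupType) (f : UMagmaMorphism.type G H) (x : G) n :
  f (zexpg x n) = zexpg (f x) n.
Proof. by case: n => n /=; rewrite ?gmulfV gmulfXn. Qed.

Lemma commuteJ (G : groupType) (x y z : G) :
  commute x y -> commute (x ^ z) (y ^ z).
Proof. by rewrite /commute -!conjMg => ->. Qed.

(** * Generated subgroups *)

Section GeneratedTheory.
Variable G : groupType.
Implicit Types (S : set G) (x y : G).

Lemma sub_generated S : S `<=` generated S.
Proof. by move=> x Sx H [_ SH]; apply: SH. Qed.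

Lemma generated1 S : generated S 1.
Proof. by have [/set_mem] := generated_group_closed S. Qed.

Lemma generatedM S x y : generated S x -> generated S y -> generated S (x * y).
Proof.
move=> Sx Sy; apply/set_mem.
by apply: (group_closedM (generated_group_closed S)); apply/mem_set.
Qed.

Lemma generatedV S x : generated S x -> generated S x^-1.
Proof.
move=> Sx; apply/set_mem.
by apply: (group_closedV (generated_group_closed S)); apply/mem_set.
Qed.

Lemma generatedMl S x y :
  generated S x -> generated S (x * y) <-> generated S y.
Proof.
move=> Sx; split=> [Sxy|]; last exact: generatedM.
by rewrite -(mulKg x y); apply: generatedM => //; apply: generatedV.
Qed.

Lemma generatedJ S x y : generated S x -> generated S y -> generated S (x ^ y).
Proof.
by move=> Sx Sy; apply: generatedM; [apply: generatedV|apply: generatedM].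
Qed.

Lemma generated_zexpg S x n : generated S x -> generated S (zexpg x n).
Proof.
move=> Sx; elim/int_ind_succ: n => [|n]; first exact: generated1.
by rewrite zexpgS generatedMl.
Qed.

Lemma generated_prod S (I : Type) (r : seq I) (F : I -> G) :
  (forall i, generated S (F i)) -> generated S (\prod_(i <- r) F i).
Proof.
move=> SF; elim/big_ind: _ => // [|x y]; first exact: generated1.
exact: generatedM.
Qed.

End GeneratedTheory.

(** The preimage of [generated S'] under [f] is a subgroup containing [S], so minimality of
    [generated S] applies. *)
Lemma generated_morph (G H : groupType) (f : UMagmaMorphism.type G H)
    (S : set G) (S' : set H) :
  (forall x, S x -> generated S' (f x)) ->
  forall x, generated S x -> generated S' (f x).
Proof.
move=> SS' x Sx; apply: (Sx [set y | generated S' (f y)]); split=> //; split.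
  by apply/mem_set; rewrite /= gmulf1; apply: generated1.
move=> y z /set_mem Sy /set_mem Sz; apply/mem_set => /=.
by rewrite gmulfM gmulfV; apply: generatedM => //; apply: generatedV.
Qed.

Lemma generated_sub (G : groupType) (S S' : set G) :
  S `<=` generated S' -> generated S `<=` generated S'.
Proof. exact: (@generated_morph G G idfun). Qed.

Lemma isomorphic_bij (G H : groupType) (f : G -> H) :
    {morph f : x y / x * y} -> injective f -> (forall y, exists x, f x = y) ->
  isomorphic G H.
Proof.
move=> fM fI /choice[g gK].
pose fm : {multiplicative G -> H} :=
  HB.pack f (isMultiplicative.Build G H f fM).
by exists fm; exists g => // x; apply: fI; rewrite gK.
Qed.

(** * From a morphism with prescribed image to a factor or an isomorphism *)

Section FirstIsomorphism.
Variables (L G : groupType) (f : UMagmaMorphism.type L G) (S : set G).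
Hypothesis imf : generated S = range f.
Local Open Scope quotient_scope.

Lemma ker_group_closed : group_closed (mem [set x | f x = 1]).
Proof.
split=> [|x y /set_mem/= fx /set_mem/= fy]; apply/mem_set => /=.
  exact: gmulf1.
by rewrite gmulfF fx fy divg1.
Qed.

Lemma ker_conj (x y : L) :
  x \in [set x | f x = 1] -> x ^ y \in [set x | f x = 1].
Proof. by move=> /set_mem/= fx; apply/mem_set; rewrite /= gmulfJ fx conj1g. Qed.

Definition ker := NormalSubgroup ker_group_closed ker_conj.

(** [f] is constant on cosets of its kernel; evaluating it at the canonical representative thus
    gives a morphism on the quotient. *)
Lemma repr_ker x : f (repr (\pi_(quotient ker) x)) = f x.
Proof.
have /set_mem/= := repr_rel ker x; rewrite gmulfM gmulfV => /mulg1_eq.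
by rewrite invgK.
Qed.

Lemma im_generated x : f x \in generated S.
Proof. by rewrite imf; apply/mem_set; exists x. Qed.

Lemma first_isomorphism : iso_factor (generated_group S) L.
Proof.
exists ker.
pose g (u : quotient ker) : generated_group S :=
  exist _ (f (repr u)) (im_generated _).
apply: (@isomorphic_bij _ _ g)
  => [u v|u v|[y Sy]].
- by apply/val_inj; rewrite valM /= -gmulfM repr_ker.
- move=> /(congr1 val)/= fuv; rewrite -[u]reprK -[v]reprK; apply/quotient_eqP.
  by apply/mem_set; rewrite /= gmulfM gmulfV fuv mulVg.
- have [x _ fx] : range f y by rewrite -imf; apply/set_mem.
  by exists (\pi x); apply/val_inj; rewrite /= repr_ker.
Qed.

Lemma inj_isomorphic : injective f -> isomorphic (generated_group S) L.
Proof.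
move=> fI; have fS (y : generated_group S) : exists x, f x = val y.
  have [x _ <-] : range f (val y) by rewrite -imf; apply/set_mem/(valP y).
  by exists x.
have [g gK] := choice fS.
apply: (@isomorphic_bij _ _ g) => [x y|x y gxy|x].
- by apply: fI; rewrite gmulfM !gK valM.
- by apply: val_inj; rewrite -!gK gxy.
- exists (exist _ (f x) (im_generated x)); apply: fI; exact: gK.
Qed.

End FirstIsomorphism.

(* Products in a noncommutative group depend on the order of the factors;
   listing the indices increasingly makes them independent of the index set. *)
Lemma eq_big_lt_sorted (G : groupType) (s t : seq int) (F : int -> G) :
    sorted <%O%R s -> sorted <%O%R t ->
    (forall k, F k != 1 -> (k \in s) && (k \in t)) ->
  \prod_(k <- s) F k = \prod_(k <- t) F k.
Proof.
move=> s_sorted t_sorted Fst.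
have supp r : \prod_(k <- r) F k = \prod_(k <- [seq k <- r | F k != 1]) F k.
  by rewrite big_filter [RHS]big_mkcond; apply: eq_bigr => k _; case: eqP.
rewrite supp [RHS]supp; congr (\prod_(k <- _) F k).
apply: lt_sorted_eq; rewrite ?sorted_filter //; try exact: lt_trans.
by move=> k; rewrite !mem_filter; case: eqP => // /eqP/Fst/andP[-> ->].
Qed.

(** * The morphism sending alpha_0 to [a] and beta to [b] *)

Definition lamp_alpha : lamplighter :=
  ([fsfun k in [fset 0%R]%fset => 1%R], 0%R).
Definition lamp_beta : lamplighter := ([fsfun], 1%R).

Lemma lamp_alphaE (k : int) : lamp_alpha.1 k = (k == 0%R)%:R%R.
Proof. by rewrite fsfunE in_fset1; case: eqP. Qed.

Section LamplighterMorphism.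
Variables (G : groupType) (a b : G).

(** The intended image of alpha_k = beta^k alpha_0 beta^-k; as [x ^ y] means [y^-1 * x * y], the
    exponent is [- k]. *)
Definition lamp_conj (k : int) : G := a ^ zexpg b (- k)%R.

Definition lamp_prod (s : seq int) (u : int -> int) : G :=
  \prod_(k <- s) zexpg (lamp_conj k) (u k).

Definition lamp_hom (x : lamplighter) : G :=
  lamp_prod (sort <=%O%R (finsupp x.1)) x.1 * zexpg b x.2.

(** The freedom to enlarge the index list lets several elements share one list. *)
Lemma lamp_homE s (x : lamplighter) :
    sorted <%O%R s -> (forall k, x.1 k != 0%R -> k \in s) ->
  lamp_hom x = lamp_prod s x.1 * zexpg b x.2.
Proof.
move=> s_sorted xs; congr (_ * _); apply: eq_big_lt_sorted => // [|k xk].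
  by rewrite sort_lt_sorted fset_uniq.
have xk0 : x.1 k != 0%R by apply: contraNneq xk => ->.
by rewrite mem_sort mem_finsupp xk0 xs.
Qed.

Lemma generated_lamp_hom x : generated [set a; b] (lamp_hom x).
Proof.
have Sa : generated [set a; b] a by apply: sub_generated; left.
have Sb : generated [set a; b] b by apply: sub_generated; right.
apply: generatedM; last exact: generated_zexpg.
apply: generated_prod => k; apply: generated_zexpg.
by apply: generatedJ => //; apply: generated_zexpg.
Qed.

Lemma lamp_conj0 : lamp_conj 0 = a.
Proof. by rewrite /lamp_conj oppr0 conjg1. Qed.

Lemma lamp_hom_alpha : lamp_hom lamp_alpha = a.
Proof.
rewrite (@lamp_homE [:: 0%R]) // => [|k].
  by rewrite /lamp_prod big_seq1 lamp_alphaE lamp_conj0 mulg1.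
by rewrite lamp_alphaE inE; case: (k == 0%R) => //=; rewrite eqxx.
Qed.

Lemma lamp_hom_beta : lamp_hom lamp_beta = b.
Proof.
rewrite (@lamp_homE [::]) // => [|k]; last by rewrite fsfun0E eqxx.
by rewrite /lamp_prod big_nil mul1g.
Qed.

Hypothesis aC : forall n : nat, commute a (a ^ zexpg b (- n%:Z)%R).

(** By symmetry [k <= l]; conjugation by a power of [b] then moves the pair to the indices [0] and
    [l - k], where [aC] applies. *)
Lemma lamp_conjC k l : commute (lamp_conj k) (lamp_conj l).
Proof.
wlog kl : k l / (k <= l)%R => [aC'|].
  by case: (leP k l) => [/aC'//|/ltW/aC'/commute_sym].
have -> : lamp_conj l = (a ^ zexpg b (- `|l - k|%N%:Z)%R) ^ zexpg b (- k)%R.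
  by rewrite -conjgM -zexpgD gez0_abs ?subr_ge0 // opprB addrAC subrr add0r.
exact/commuteJ/aC.
Qed.

Lemma lamp_homM : {morph lamp_hom : x y / x * y}.
Proof.
move=> x y.
(* [sx] contains the support of [x.1] and that of [y.1] translated by [x.2], hence also that of the
   product. *)
pose sx := sort <=%O%R
  (undup (finsupp x.1 ++ [seq (x.2 + k)%R | k <- finsupp y.1])).
pose sy := sort <=%O%R (finsupp y.1).
have sx_sorted : sorted <%O%R sx by rewrite sort_lt_sorted undup_uniq.
have sy_sorted : sorted <%O%R sy by rewrite sort_lt_sorted fset_uniq.
have xs k : x.1 k != 0%R -> k \in sx.
  by move=> xk; rewrite mem_sort mem_undup mem_cat mem_finsupp xk.
have ys k : y.1 (k - x.2)%R != 0%R -> k \in sx.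
  move=> yk; rewrite mem_sort mem_undup mem_cat; apply/orP; right.
  by apply/mapP; exists (k - x.2)%R; rewrite ?mem_finsupp // addrC subrK.
rewrite (@lamp_homE sx (x * y)) // => [|k]; last first.
  rewrite /= !fsE => xyk; case: (eqVneq (x.1 k) 0%R) => [xk|/xs//].
  by apply: ys; apply: contraNneq xyk => ->; rewrite xk.
rewrite (@lamp_homE sx x) // (@lamp_homE sy y) //; last first.
  by move=> k yk; rewrite mem_sort mem_finsupp.
have -> : lamp_prod sx (x * y).1 =
    lamp_prod sx x.1 * lamp_prod sx (fun k => y.1 (k - x.2)%R).
  rewrite -prodgM_commute => [|k l _ _].
    by apply: eq_bigr => k _; rewrite /= !fsE zexpgD.
  by apply/commute_zexpg/commute_sym/commute_zexpg/lamp_conjC.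
(* Conjugation by [zexpg b (- x.2)] turns [lamp_conj k] into [lamp_conj (x.2 + k)], which matches
   the translation in the wreath product. *)
have -> : lamp_prod sx (fun k => y.1 (k - x.2)%R) =
    lamp_prod sy y.1 ^ zexpg b (- x.2)%R.
  transitivity
    (lamp_prod [seq (x.2 + k)%R | k <- sy] (fun k => y.1 (k - x.2)%R)).
    apply: eq_big_lt_sorted => // [|k].
      rewrite sorted_map; apply: sub_sorted sy_sorted => k l /=.
      by rewrite ltrD2l.
    have [->|yk _] := eqVneq (y.1 (k - x.2)%R) 0%R; first by rewrite eqxx.
    rewrite ys //; apply/mapP; exists (k - x.2)%R; last by rewrite addrC subrK.
    by rewrite mem_sort mem_finsupp.
  rewrite /lamp_prod big_map conjg_prod; apply: eq_bigr => k _.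
  rewrite conjg_zexpg /lamp_conj -conjgM -zexpgD -opprD (addrC k).
  by rewrite [(x.2 + k - x.2)%R]addrAC subrr add0r.
by rewrite zexpgD conjgE zexpgN invgK !mulgA mulgVK.
Qed.

Lemma lamp_hom_monoid_morphism : monoid.monoid_morphism lamp_hom.
Proof.
split; last exact: lamp_homM.
by apply: (mulgI (lamp_hom 1)); rewrite -lamp_homM !mulg1.
Qed.

Definition lamp_morphism : UMagmaMorphism.type lamplighter G :=
  HB.pack lamp_hom
    (isUMagmaMorphism.Build lamplighter G lamp_hom lamp_hom_monoid_morphism).

Lemma range_lamp_morphism : generated [set a; b] = range lamp_morphism.
Proof.
apply/seteqP; split=> [g|_ [x _ <-]]; last exact: generated_lamp_hom.
apply; split=> [|_ [->|->]]; last 2 first.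
- by exists lamp_alpha => //; apply: lamp_hom_alpha.
- by exists lamp_beta => //; apply: lamp_hom_beta.
split=> [|_ _ /set_mem[x _ <-] /set_mem[y _ <-]]; apply/mem_set.
  by exists 1; rewrite ?gmulf1.
by exists (x / y); rewrite ?gmulfF.
Qed.

End LamplighterMorphism.

(** * Coordinates in the lamplighter group *)

Section LamplighterGenerators.
Implicit Types (x y : lamplighter) (k n : int).

Lemma lamp_mul1E x y k : (x * y).1 k = (x.1 k + y.1 (k - x.2))%R.
Proof. by rewrite /= !fsE. Qed.

Lemma lamp_inv1E x k : (x^-1).1 k = (- x.1 (k + x.2))%R.
Proof. by rewrite /= !fsE opprK. Qed.

Lemma lamp_one1E k : (1 : lamplighter).1 k = 0%R.
Proof. exact: fsfun0E. Qed.

Lemma lamp_mul2E x y : (x * y).2 = (x.2 + y.2)%R.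
Proof. by []. Qed.

Lemma lamp_inv2E x : (x^-1).2 = (- x.2)%R.
Proof. by []. Qed.

Definition lampE :=
  (lamp_mul1E, lamp_mul2E, lamp_inv1E, lamp_inv2E, lamp_one1E).

Lemma lampP x y : (forall k, x.1 k = y.1 k) -> x.2 = y.2 -> x = y.
Proof. by case: x y => [u n] [v m] /= uv ->; congr (_, _); apply/fsfunP. Qed.

Lemma zexpg_lamp2 x n : (zexpg x n).2 = (x.2 * n)%R.
Proof.
elim/int_ind_succ: n => [|n]; first by rewrite mulr0.
by rewrite zexpgSr lampE mulrDr mulr1; split=> [->//|]; apply: addIr.
Qed.

Lemma zexpg_lamp1 x n k : x.2 = 0%R -> (zexpg x n).1 k = (x.1 k * n)%R.
Proof.
move=> x2; elim/int_ind_succ: n => [|n]; first by rewrite mulr0 lampE.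
rewrite zexpgSr !lampE zexpg_lamp2 x2 mul0r subr0 mulrDr mulr1.
by split=> [->//|]; apply: addIr.
Qed.

Lemma zexpg_lamp_beta1 n k : (zexpg lamp_beta n).1 k = 0%R.
Proof.
elim/int_ind_succ: n => [|n]; first by rewrite lampE.
by rewrite zexpgSr lampE [lamp_beta.1 _]fsfun0E addr0.
Qed.

Lemma zexpg_lamp_beta2 n : (zexpg lamp_beta n).2 = n.
Proof. by rewrite zexpg_lamp2 mul1r. Qed.

Lemma lamp_conj1 k l : (lamp_conj lamp_alpha lamp_beta k).1 l = (l == k)%:R%R.
Proof.
rewrite /lamp_conj conjgE !lampE lamp_alphaE !zexpg_lamp_beta1.
by rewrite zexpg_lamp_beta2 oppr0 add0r addr0 opprK subr_eq0.
Qed.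

Lemma lamp_conj2 k : (lamp_conj lamp_alpha lamp_beta k).2 = 0%R.
Proof. by rewrite /lamp_conj conjgE !lampE add0r addNr. Qed.

Lemma lamp_prod2 s u : (lamp_prod lamp_alpha lamp_beta s u).2 = 0%R.
Proof.
elim: s => [|k s IHs]; first by rewrite /lamp_prod big_nil.
by rewrite /lamp_prod big_cons lampE IHs zexpg_lamp2 lamp_conj2 mul0r.
Qed.

Lemma lamp_prod1 s u l : uniq s ->
  (lamp_prod lamp_alpha lamp_beta s u).1 l = if l \in s then u l else 0%R.
Proof.
elim: s => [|k s IHs] /=; first by rewrite /lamp_prod big_nil lampE.
move=> /andP[ks /IHs{}IHs]; rewrite /lamp_prod big_cons lampE.
rewrite zexpg_lamp2 zexpg_lamp1 ?lamp_conj2 // mul0r subr0 IHs lamp_conj1 inE.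
by case: eqP => [->|] /=; rewrite ?(negPf ks) ?mul1r ?addr0 ?mul0r ?add0r.
Qed.

(** This is the normal form of [x] as a product of powers of the alpha_k followed by a power of
    beta; it yields injectivity in the universal example. *)
Lemma lamp_hom_id x : lamp_hom lamp_alpha lamp_beta x = x.
Proof.
apply: lampP => [k|]; last by rewrite lampE lamp_prod2 zexpg_lamp_beta2 add0r.
rewrite lampE zexpg_lamp_beta1 addr0 lamp_prod1 ?sort_uniq ?fset_uniq //.
by rewrite mem_sort; case: finsuppP.
Qed.

End LamplighterGenerators.

(** * Evaluation of sequences and elementary properties of differences *)

Section SequenceEvaluation.
Variables (G : groupType) (m : int).

Definition zseq_eval (T : zseq G) : G := T m.

Lemma zseq_eval_monoid_morphism : monoid.monoid_morphism zseq_eval.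
Proof. by []. Qed.

HB.instance Definition _ :=
  isUMagmaMorphism.Build (zseq G) G zseq_eval zseq_eval_monoid_morphism.

End SequenceEvaluation.

Section SequenceTheory.
Variables (G : groupType).
Implicit Types (U V : zseq G) (m n : int).

Lemma zseqP U V : (forall m, zseq_eval m U = zseq_eval m V) -> U = V.
Proof. by move=> UV; apply/funext => m; apply: UV. Qed.

Lemma zseq_evalM m U V : zseq_eval m (U * V) = zseq_eval m U * zseq_eval m V.
Proof. by []. Qed.

Lemma zseq_evalJ m U V : zseq_eval m (U ^ V) = zseq_eval m U ^ zseq_eval m V.
Proof. by []. Qed.

Lemma zseq_evalX m U n : zseq_eval m (zexpg U n) = zexpg (zseq_eval m U) n.
Proof. exact: (gmulf_zexpg (zseq_eval m)). Qed.

End SequenceTheory.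

Lemma Delta0 (G : groupType) (T : zseq G) : Delta 0 T = 1.
Proof. by apply/funext => m; rewrite /Delta add0r mulgV. Qed.

Lemma DeltaS (G : groupType) (T : zseq G) i m :
  Delta (i + 1)%R T m = Delta 1 T (i + m)%R * Delta i T m.
Proof. by rewrite /Delta addrAC addrC !addrA (addrC _ i) mulgA mulgVK. Qed.

Lemma quadratic_leibmanP (G : groupType) (T : zseq G) :
  quadratic_leibman T <->
  forall i j m, Delta j (Delta i T) m = Delta j (Delta i T) 0%R.
Proof.
split=> [qT i j m|DDT s].
  (* A third difference of step [m], read at position 0, compares the values at [m] and at 0. *)
  have := congr1 (fun U : zseq G => U 0%R) (qT [tuple i; j; m]).
  by rewrite /= {1}/Delta addr0 => /divg1_eq.
case: s => [[|i [|j [|k [|]]]]] //= _; apply/funext => m.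
by rewrite {1}/Delta DDT [X in _ / X]DDT mulgV.
Qed.

(** * Relations and generators for an arbitrary quadratic sequence *)

Section QuadraticSequence.
Variables (G : groupType) (T : zseq G).
Hypothesis qT : quadratic_leibman T.

Let A : zseq G := Delta 1 (Delta 1 T).
Let B : zseq G := Delta 1 T.

Let DDT i j m : Delta j (Delta i T) m = Delta j (Delta i T) 0%R.
Proof. exact: (quadratic_leibmanP T).1. Qed.

Lemma Delta1_shift i m : B (i + m)%R = zexpg (A 0%R) i * B m.
Proof.
elim/int_ind_succ: i => [|i]; first by rewrite add0r mul1g.
have -> : B (i + 1 + m)%R = A 0%R * B (i + m)%R.
  by rewrite -addrA addrCA /A -(DDT 1 1 (i + m)); apply/esym/mulgVK.
by rewrite zexpgS -(mulgA (A 0%R) (zexpg _ _)); split=> [->//|/mulgI].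
Qed.

Let c i : G := Delta 1 (Delta i T) 0%R.

(** Expanding both values of [Delta (i + 1) T] by [DeltaS] gives
    [B (1 + (i + m)) * c i * (B (i + m))^-1]; [Delta1_shift] then extracts the powers of [A 0]. *)
Lemma DDelta_succ_conj i m :
  c (i + 1)%R = A 0%R * (c i ^ (B m)^-1) ^ zexpg (A 0%R) (- i)%R.
Proof.
rewrite /c -(DDT _ _ m) -[in RHS](DDT _ _ m) {1 3}/Delta !DeltaS -!/B.
have -> : (i + (1 + m))%R = (1 + (i + m))%R by rewrite addrCA.
rewrite (Delta1_shift 1) !Delta1_shift -/(zexpg _ 1) zexpgN !conjgE !invgK.
by rewrite !invgM !mulgA.
Qed.

(** The left side of [DDelta_succ_conj] does not involve [m]. Comparing [m] with [1 + m], where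
    [B (1 + m) = A 0 * B m], shows that conjugation by [(A 0)^-1] fixes the element. *)
Lemma commute_conj_DDelta i m : commute (A 0%R) (c i ^ (B m)^-1).
Proof.
have : c i ^ (B m)^-1 = (c i ^ (B m)^-1) ^ (A 0%R)^-1.
  have := DDelta_succ_conj i (1 + m); rewrite (DDelta_succ_conj i m).
  move=> /mulgI/conjg_inj {1}->.
  by rewrite Delta1_shift invgM conjgM.
move: (A 0%R) (c i ^ _) => a x xa.
by rewrite /commute [in RHS]xa conjgE invgK !mulgA mulgVK.
Qed.

Lemma DDelta_succ i m : c (i + 1)%R = A 0%R * c i ^ (B m)^-1.
Proof.
rewrite (DDelta_succ_conj i m); congr (_ * _); apply/conjg_fixP/commgP.
exact/commute_zexpg/commute_sym/commute_conj_DDelta.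
Qed.

Lemma commute_DDelta i : commute (A 0%R) (c i).
Proof.
(* Writing [i] as [(i - 1) + 1] exhibits [c i] as a product of two elements commuting with [A 0]. *)
rewrite -[i](subrK 1%R) (DDelta_succ _ 0).
by apply: commuteM => //; apply: commute_conj_DDelta.
Qed.

Lemma DDelta_ratio (n : nat) m :
  (c n)^-1 * c (n%:Z + 1)%R = A 0%R ^ zexpg (B m) (- n%:Z)%R.
Proof.
elim: n => [|n IHn].
  (* Base case: [c 0] is trivial and [c 1] is [A 0]. *)
  rewrite oppr0 conjg1 /c Delta0 add0r (_ : Delta 1 1 0%R = 1) ?invg1 ?mul1g //.
  exact: mulgV.
have -> : (n.+1%:Z = n%:Z + 1)%R by rewrite intS addrC.
rewrite (DDelta_succ (n%:Z + 1)%R m) {1}(DDelta_succ n m) invgM.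
by rewrite -(mulgA (_ ^ _)^-1) mulKg -conjVg -conjMg IHn -conjgM opprD zexpgD.
Qed.

Lemma commute_conj_Delta (n : nat) m :
  commute (A 0%R) (A 0%R ^ zexpg (B m) (- n%:Z)%R).
Proof.
rewrite -DDelta_ratio; apply: commuteM; last exact: commute_DDelta.
exact/commuteV/commute_DDelta.
Qed.

Lemma zseq_eval_DDelta m : zseq_eval m A = A 0%R.
Proof. exact: DDT. Qed.

(** Checked position by position: [A] is constant but [B] is not, so the relation in [G] is needed
    with [B m] for every [m]. *)
Lemma commute_conj_seq (n : nat) : commute A (A ^ zexpg B (- n%:Z)%R).
Proof.
apply: zseqP => m; rewrite (zseq_evalM m A) (zseq_evalM m _ A).
rewrite zseq_evalJ zseq_evalX zseq_eval_DDelta.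
exact: commute_conj_Delta.
Qed.

Lemma generated_differences : generated (differences T) = generated [set A; B].
Proof.
have gA : generated [set A; B] A by apply: sub_generated; left.
have gB : generated [set A; B] B by apply: sub_generated; right.
apply/seteqP; split; apply: generated_sub; last first.
  move=> _ [->|->]; apply: sub_generated; last by left; exists 1%R.
  by right; exists 1%R => //; exists 1%R.
have gD i : generated [set A; B] (Delta i T).
  elim/int_ind_succ: i => [|i]; first by rewrite Delta0; apply: generated1.
  (* The factor [B (i + m)] from [DeltaS] is the value at [m] of the sequence [zexpg A i * B]. *)
  have -> : Delta (i + 1)%R T = (zexpg A i * B) * Delta i T.
    apply: zseqP => m; rewrite (zseq_evalM m (_ * _)).
    rewrite (zseq_evalM m (zexpg A i)) zseq_evalX zseq_eval_DDelta /zseq_eval DeltaS.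
    by congr (_ * _); apply: Delta1_shift.
  by rewrite generatedMl //; apply: generatedM => //; apply: generated_zexpg.
have gDD i : generated [set A; B] (Delta 1 (Delta i T)).
  elim/int_ind_succ: i => [|i].
    have -> : Delta 1 (Delta 0 T) = 1.
      by rewrite Delta0; apply/funext => m; apply: mulgV.
    exact: generated1.
  have -> : Delta 1 (Delta (i + 1)%R T) = A * Delta 1 (Delta i T) ^ B^-1.
    apply: zseqP => m; rewrite zseq_evalM zseq_evalJ zseq_eval_DDelta.
    by rewrite /zseq_eval DDT [X in X ^ _]DDT; apply: DDelta_succ.
  rewrite (generatedMl _ gA); split=> gc.
    by apply: generatedJ => //; apply: generatedV.
  (* Descending direction: conjugation by [B] undoes conjugation by [B^-1]. *)
  by have := generatedJ gc gB; rewrite -conjgM mulVg conjg1.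
move=> _ [[i _ <-]|[j _ [i _ <-]]] //.
elim/int_ind_succ: j => [|j]; first by rewrite Delta0; apply: generated1.
(* Since [Delta 1 (Delta i T)] is constant, the translation of its argument in [DeltaS] can be
   ignored. *)
have -> : Delta (j + 1)%R (Delta i T) =
    Delta 1 (Delta i T) * Delta j (Delta i T).
  apply/funext => m; by rewrite DeltaS DDT -(DDT _ _ m).
by apply: iff_sym; apply: generatedMl; apply: gDD.
Qed.

Lemma generated_difference_values :
  generated (difference_values T) = generated [set A 0%R; B 0%R].
Proof.
have gA : generated [set A 0%R; B 0%R] (A 0%R) by apply: sub_generated; left.
have gB : generated [set A 0%R; B 0%R] (B 0%R) by apply: sub_generated; right.
apply/seteqP; split; apply: generated_sub; last first.
  move=> _ [->|->]; apply: sub_generated.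
    by exists A; [right; exists 1%R => //; exists 1%R | exists 0%R].
  by exists B; [left; exists 1%R | exists 0%R].
move=> _ [U TU [m _ <-]].
(* Evaluation at [m] sends the generators [A] and [B] to [A 0] and [zexpg (A 0) m * B 0]. *)
apply: (@generated_morph _ _ (zseq_eval m) [set A; B]); last first.
  by rewrite -generated_differences; apply: sub_generated.
move=> _ [->|->]; first by rewrite [X in generated _ X]zseq_eval_DDelta.
rewrite [X in generated _ X](_ : _ = zexpg (A 0%R) m * B 0%R); last first.
  by rewrite -Delta1_shift addr0.
apply: generatedM => //.
exact: generated_zexpg.
Qed.

Lemma iso_factor_differences :
  iso_factor (generated_group (differences T)) lamplighter.
Proof.
apply: (@first_isomorphism _ _ (lamp_morphism commute_conj_seq)).
rewrite generated_differences; exact: range_lamp_morphism.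
Qed.

Lemma iso_factor_difference_values :
  iso_factor (generated_group (difference_values T)) lamplighter.
Proof.
apply: (@first_isomorphism _ _ (lamp_morphism (commute_conj_Delta^~ 0%R))).
rewrite generated_difference_values; exact: range_lamp_morphism.
Qed.

End QuadraticSequence.

(** Used with evaluation at 0 to pass from sequences to their values. *)
Lemma gmulf_lamp_hom (G H : groupType) (f : UMagmaMorphism.type G H)
    (a b : G) x :
  f (lamp_hom a b x) = lamp_hom (f a) (f b) x.
Proof.
rewrite /lamp_hom gmulfM gmulf_zexpg gmulf_prod; congr (_ * _).
by apply: eq_bigr => k _; rewrite gmulf_zexpg gmulfJ gmulf_zexpg.
Qed.

(** * The universal example in the lamplighter group *)

Section UniversalSequence.
Implicit Types i j k m : int.

Definition heaviside k : int := (0 <= k)%R%:R%R.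

(* For 0 < i this lists the exponents of
   a^(i-1) b a^(i-2) b ... a^0 b with a = alpha_0, b = beta; the difference of step
   functions is the signed indicator of the integers between 0 and i. *)
Definition lamp_seq_lamps i k : int :=
  ((heaviside k - heaviside (k - i)) * (i - 1 - k))%R.

(** The listed indices run from [- |i|] to [|i| - 1] and cover the support for either sign of
    [i]. *)
Definition lamp_seq : zseq lamplighter := fun i =>
  ([fsfun k in seq_fset tt [seq (n%:Z - `|i|)%R | n <- iota 0 (2 * `|i|%N)] =>
      lamp_seq_lamps i k], i).

Lemma lamp_seq1E i k : (lamp_seq i).1 k = lamp_seq_lamps i k.
Proof.
rewrite fsfunE; case: ifPn => // /negP kN; rewrite /lamp_seq_lamps /heaviside.
have [->|h] := eqVneq (0 <= k)%R (0 <= k - i)%R; first by rewrite subrr mul0r.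
case: kN; rewrite seq_fsetE; apply/mapP; exists `|(k + `|i|)%R|%N.
  rewrite mem_iota; lia.
lia.
Qed.

(** After translation both terms carry the factor [i + m - 1 - k], and the step functions
    telescope. *)
Lemma Delta_lamp_seq1 i m k : (Delta i lamp_seq m).1 k =
  ((heaviside k - heaviside (k - i)) * (i + m - 1 - k))%R.
Proof.
rewrite /Delta !lampE !lamp_seq1E /lamp_seq_lamps /=.
have -> : (k - (i + m) + m = k - i)%R by ring.
have -> : (k - i - m = k - (i + m))%R by ring.
ring.
Qed.

Lemma Delta_lamp_seq2 i m : (Delta i lamp_seq m).2 = i.
Proof. by rewrite /Delta !lampE /= addrK. Qed.

(** Both values of [Delta i lamp_seq] translate by [i], so their lamps subtract in place; being
    affine in the position, they leave no dependence on [m]. *)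
Lemma DDelta_lamp_seq1 i j m k : (Delta j (Delta i lamp_seq) m).1 k =
  ((heaviside k - heaviside (k - i)) * j)%R.
Proof.
rewrite {1}/Delta lamp_mul1E lamp_inv1E !Delta_lamp_seq2 !Delta_lamp_seq1 subrK.
ring.
Qed.

Lemma DDelta_lamp_seq2 i j m : (Delta j (Delta i lamp_seq) m).2 = 0%R.
Proof. by rewrite {1}/Delta lamp_mul2E lamp_inv2E !Delta_lamp_seq2 subrr. Qed.

Lemma quadratic_lamp_seq : quadratic_leibman lamp_seq.
Proof.
apply/quadratic_leibmanP => i j m.
by apply: lampP => [k|]; rewrite ?DDelta_lamp_seq1 ?DDelta_lamp_seq2.
Qed.

Lemma heaviside_succ k : (heaviside k - heaviside (k - 1) = (k == 0)%:R)%R.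
Proof.
rewrite /heaviside; have [k0|k0|->] := ltrgtP k 0%R; last by [].
  by have -> : (0 <= k - 1)%R = false by lia.
by have -> : (0 <= k - 1)%R = true by lia.
Qed.

Lemma DDelta_lamp_seq : Delta 1 (Delta 1 lamp_seq) 0 = lamp_alpha.
Proof.
apply: lampP => [k|]; last by rewrite DDelta_lamp_seq2.
by rewrite DDelta_lamp_seq1 heaviside_succ mulr1 lamp_alphaE.
Qed.

Lemma Delta_lamp_seq : Delta 1 lamp_seq 0 = lamp_beta.
Proof.
apply: lampP => [k|]; last by rewrite Delta_lamp_seq2.
rewrite Delta_lamp_seq1 heaviside_succ [RHS]fsfun0E.
(* At [k = 0] the linear factor [1 + 0 - 1 - k] vanishes. *)
by case: eqP => [->|_]; rewrite ?mul0r.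
Qed.

Lemma isomorphic_differences :
  isomorphic (generated_group (differences lamp_seq)) lamplighter.
Proof.
have qT := quadratic_lamp_seq.
apply: (@inj_isomorphic _ _ (lamp_morphism (commute_conj_seq qT))).
  rewrite (generated_differences qT); exact: range_lamp_morphism.
(* Evaluation at 0 is a left inverse: the composite is [lamp_hom lamp_alpha lamp_beta], the
   identity. *)
apply: (can_inj (g := zseq_eval 0%R)) => x.
rewrite [LHS](gmulf_lamp_hom (zseq_eval 0%R)) -[RHS]lamp_hom_id.
by rewrite -DDelta_lamp_seq -Delta_lamp_seq.
Qed.

Lemma isomorphic_difference_values :
  isomorphic (generated_group (difference_values lamp_seq)) lamplighter.
Proof.
have qT := quadratic_lamp_seq.
apply: (@inj_isomorphic _ _ (lamp_morphism ((commute_conj_Delta qT)^~ 0%R))).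
  rewrite (generated_difference_values qT); exact: range_lamp_morphism.
apply: (can_inj (g := id)) => x; rewrite -[RHS]lamp_hom_id.
by rewrite -DDelta_lamp_seq -Delta_lamp_seq.
Qed.

End UniversalSequence.

Theorem proposition2p8 :
  (forall (G : groupType) (T : zseq G), quadratic_leibman T ->
     let A : zseq G := Delta 1 (Delta 1 T) in
     let B : zseq G := Delta 1 T in
     [/\ iso_factor (generated_group (differences T)) lamplighter,
         generated (differences T) = generated [set A; B],
         iso_factor (generated_group (difference_values T)) lamplighter
       & generated (difference_values T) = generated [set A 0; B 0]]) /\
  (exists (G : groupType) (T : zseq G),
     [/\ quadratic_leibman T,
         isomorphic (generated_group (differences T)) lamplighter
       & isomorphic (generated_group (difference_values T)) lamplighter]).
Proof.
split=> [G T qT A B|].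
  split; [exact: iso_factor_differences|exact: generated_differences| |].
    exact: iso_factor_difference_values.
  exact: generated_difference_values.
exists lamplighter, lamp_seq; split; first exact: quadratic_lamp_seq.
  exact: isomorphic_differences.
exact: isomorphic_difference_values.
Qed.
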